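(* Let $K\ge 0$ be an integer and let $\{a_k\}_k\subseteq(0,\infty)$ satisfy $$a_{k+1}\le\Big(1-\frac{c}{(k+\gamma)^\nu}\Big)a_k+\frac{d}{(k+\gamma)^{\nu+q}}\qquad\text{for all }k\in[K],$$ where $\nu\in(0,1]$, $q>0$, $c,d>0$, $\gamma\ge c^{1/\nu}$. Then: (a) If $\nu\in(0,1)$, $\gamma\ge c^{1/\nu}$ and $\gamma>(q/c)^{\frac{1}{1-\nu}}$, then for all $k\in[K]$ $$a_{k+1}\le\frac{\lambda d}{c}(k+1+\gamma)^{-q}+\Big(a_0-\frac{\lambda d}{c\gamma^q}\Big)^+\exp\Big(\frac{c\gamma^{1-\nu}}{1-\nu}\Big)\exp\Big(-\frac{c(k+1+\gamma)^{1-\nu}}{1-\nu}\Big),$$ where $\lambda=\frac{c\gamma^{1-\nu}}{c\gamma^{1-\nu}-q}$. (b) If $\nu=1$, $c>q$ and $\gamma\ge c$, then for all $k\in[K]$ $$a_{k+1}\le\frac{d}{c-q}(k+1+\gamma)^{-q}+\gamma^c\Big(a_0-\frac{d}{(c-q)\gamma^q}\Big)^+(k+1+\gamma)^{-c}.$$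
   Context: $[K]:=\{0,1,\dots,K\}$; $(x)^+:=\max\{x,0\}$. *)

(* Defs.v *)
From Stdlib Require Import Reals.
Open Scope R_scope.

(* Real powers are [Rpower x y = exp (y * ln x)], which agrees with x^y only
   for x > 0; every base to which it is applied is to be positive. *)
Definition pos_part (x : R) : R := Rmax x 0.

(* Main.v *)
(** Write x = k + γ. The barrier b(x) = M x^(-q), with M = λd/c (resp. d/(c-q)),
    satisfies (1 - c/x^ν) b(x) + d/x^(ν+q) <= b(x+1), because
    (1 + 1/x)^(-q) >= 1 - q/x. Hence a_{k+1} - b(x+1) <= (1 - c/x^ν) (a_k - b(x)), and
    1 - c/x^ν <= exp(-c/x^ν) <= exp(h(x) - h(x+1)) for the concave primitive h of
    c x^(-ν), so the product of these factors telescopes. *)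
Require Import Defs.
From Stdlib Require Import Reals Lra Lia.
Open Scope R_scope.

Lemma exp_weighted_amgm (p y : R) :
  0 <= p <= 1 -> exp (p * y) <= p * exp y + (1 - p).
Proof.
  intros Hp.
  (* Average the tangent line of [exp] at [p * y], evaluated at [y] and at [0]. *)
  assert (Hy : exp (p * y) * (1 + (1 - p) * y) <= exp y).
  { replace (exp y) with (exp (p * y) * exp ((1 - p) * y))
      by (rewrite <- exp_plus; f_equal; ring).
    apply Rmult_le_compat_l; [left; apply exp_pos | apply exp_ineq1_le]. }
  assert (H0 : exp (p * y) * (1 - p * y) <= 1).
  { replace 1 with (exp (p * y) * exp (- (p * y))) at 2
      by (rewrite <- exp_plus, Rplus_opp_r; apply exp_0).
    apply Rmult_le_compat_l; [left; apply exp_pos |].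
    pose proof (exp_ineq1_le (- (p * y))); lra. }
  apply (Rmult_le_compat_l p) in Hy; [| lra].
  apply (Rmult_le_compat_l (1 - p)) in H0; [| lra].
  lra.
Qed.

(** Since x + 1 = x (1 + 1/x), this is ln (1 + t) <= t at t = 1/x. It serves the barrier and also
    the primitive c ln x of the case ν = 1. *)
Lemma ln_succ_diff (x : R) : 0 < x -> ln (x + 1) - ln x <= / x.
Proof.
  intros Hx.
  pose proof (Rinv_0_lt_compat x Hx).
  replace (x + 1) with (x * (1 + / x)) by (field; lra).
  rewrite ln_mult by lra.
  pose proof (exp_ineq1_le (ln (1 + / x))) as H1.
  rewrite exp_ln in H1 by lra. lra.
Qed.

(** Tangent-line bound for the convex x^(-q): the ratio of the two powers is exp (-q (ln (x+1) - ln
    x)), bounded below by exp t >= 1 + t. *)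
Lemma Rpower_opp_succ_ge (x q : R) :
  0 < x -> 0 <= q ->
  Rpower x (- q) * (1 - q / x) <= Rpower (x + 1) (- q).
Proof.
  intros Hx Hq; unfold Rpower.
  replace (- q * ln (x + 1))
    with (- q * ln x + - (q * (ln (x + 1) - ln x))) by ring.
  rewrite exp_plus.
  apply Rmult_le_compat_l; [left; apply exp_pos |].
  pose proof (exp_ineq1_le (- (q * (ln (x + 1) - ln x)))).
  pose proof (Rmult_le_compat_l q _ _ Hq (ln_succ_diff x Hx)).
  unfold Rdiv; lra.
Qed.

(** Tangent-line bound for the concave x^p; it controls the increments of the primitive when ν < 1,
    with p = 1 - ν. *)
Lemma Rpower_succ_diff (x p : R) :
  0 < x -> 0 <= p <= 1 ->
  Rpower (x + 1) p - Rpower x p <= p * Rpower x (p - 1).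
Proof.
  intros Hx Hp.
  assert (Hinv : 0 < / x) by (apply Rinv_0_lt_compat; exact Hx).
  assert (Hpred : Rpower x (p - 1) = Rpower x p * / x).
  { unfold Rminus; rewrite Rpower_plus, Rpower_Ropp, Rpower_1 by exact Hx.
    reflexivity. }
  replace (x + 1) with (x * (1 + / x)) by (field; lra).
  rewrite <- Rpower_mult_distr by lra.
  rewrite Hpred.
  (* Bernoulli's inequality for an exponent in [0,1]: the weighted bound on exp at y = ln (1 +
     1/x). *)
  assert (H : Rpower (1 + / x) p <= 1 + p * / x).
  { unfold Rpower.
    pose proof (exp_weighted_amgm p (ln (1 + / x)) Hp) as H.
    rewrite exp_ln in H by lra. lra. }
  apply (Rmult_le_compat_l (Rpower x p)) in H; [lra | left; apply exp_pos].
Qed.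

Lemma Rpower_inv_le (x y p : R) :
  0 < x -> 0 < p -> Rpower x (1 / p) <= y -> x <= Rpower y p.
Proof.
  intros Hx Hp H.
  replace x with (Rpower (Rpower x (1 / p)) p).
  - apply Rle_Rpower_l; [lra | split; [apply exp_pos | exact H]].
  - rewrite Rpower_mult; replace (1 / p * p) with 1 by (field; lra).
    apply Rpower_1; exact Hx.
Qed.

Lemma Rpower_inv_lt (x y p : R) :
  0 < x -> 0 < p -> Rpower x (1 / p) < y -> x < Rpower y p.
Proof.
  intros Hx Hp H.
  replace x with (Rpower (Rpower x (1 / p)) p).
  - apply Rlt_Rpower_l; [lra | split; [apply exp_pos | exact H]].
  - rewrite Rpower_mult; replace (1 / p * p) with 1 by (field; lra).
    apply Rpower_1; exact Hx.
Qed.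

(** After M (x+1)^(-q) is replaced by its lower bound M x^(-q) (1 - q/x), right side minus left side
    is x^(-ν-q) (c M - d - q M x^(ν-1)), which the last hypothesis makes nonnegative. *)
Lemma barrier_step (nu q c d M x : R) :
  0 < x -> 0 <= q -> 0 <= M ->
  d + q * M * Rpower x (nu - 1) <= c * M ->
  (1 - c / Rpower x nu) * (M * Rpower x (- q)) + d / Rpower x (nu + q)
    <= M * Rpower (x + 1) (- q).
Proof.
  intros Hx Hq HM H.
  pose proof (Rpower_opp_succ_ge x q Hx Hq) as Hsucc.
  apply (Rmult_le_compat_l M) in Hsucc; [| exact HM].
  apply Rle_trans with (2 := Hsucc).
  unfold Rdiv.
  rewrite <- !Rpower_Ropp.
  replace (/ x) with (Rpower x (nu - 1) * Rpower x (- nu)).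
  2:{ rewrite <- Rpower_plus. replace (nu - 1 + - nu) with (- (1)) by ring.
      rewrite Rpower_Ropp, Rpower_1 by exact Hx; reflexivity. }
  replace (- (nu + q)) with (- nu + - q) by ring.
  rewrite Rpower_plus.
  assert (Hpos : 0 <= Rpower x (- nu) * Rpower x (- q))
    by (apply Rmult_le_pos; left; apply exp_pos).
  apply (Rmult_le_compat_r _ _ _ Hpos) in H.
  lra.
Qed.

(** The induction shared by both cases, with [M] and [h] left abstract. Stating it for a_k with k <=
    K + 1 makes the base case just y <= y^+ for y = a_0 - M γ^(-q). *)
Lemma recursion_bound
  (K : nat) (a : nat -> R) (h : R -> R) (nu q c d gamma M : R)
  (Hrec : forall k : nat, (k <= K)%nat ->
     a (k + 1)%nat <= (1 - c / Rpower (INR k + gamma) nu) * a k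
                      + d / Rpower (INR k + gamma) (nu + q)) :
  0 < gamma -> 0 <= nu -> 0 <= q -> 0 <= M ->
  c <= Rpower gamma nu ->
  (forall x, gamma <= x -> d + q * M * Rpower x (nu - 1) <= c * M) ->
  (forall x, gamma <= x -> h (x + 1) - h x <= c / Rpower x nu) ->
  forall k : nat, (k <= K + 1)%nat ->
    a k <= M * Rpower (INR k + gamma) (- q)
           + pos_part (a 0%nat - M * Rpower gamma (- q))
             * exp (h gamma) * exp (- h (INR k + gamma)).
Proof.
  intros Hg Hnu Hq HM Hcg Hbar Hh.
  set (P := pos_part (a 0%nat - M * Rpower gamma (- q))).
  assert (HP : 0 <= P) by apply Rmax_r.
  induction k as [|k IH]; intros Hk.
  - simpl INR. rewrite Rplus_0_l, Rmult_assoc, <- exp_plus, Rplus_opp_r, exp_0.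
    assert (a 0%nat - M * Rpower gamma (- q) <= P) by apply Rmax_l.
    lra.
  - assert (HkK : (k <= K)%nat) by lia.
    specialize (IH ltac:(lia)).
    specialize (Hrec k HkK). rewrite Nat.add_1_r in Hrec.
    rewrite S_INR.
    replace (INR k + 1 + gamma) with (INR k + gamma + 1) by ring.
    pose proof (pos_INR k) as Hk0.
    set (x := INR k + gamma) in *.
    assert (Hgx : gamma <= x) by (unfold x; lra).
    assert (Hx : 0 < x) by lra.
    (* The induction hypothesis may be multiplied by this factor only if it is nonnegative, which
       follows from c <= γ^ν <= x^ν. *)
    assert (Hr : 0 <= 1 - c / Rpower x nu).
    { assert (Hpx : 0 < Rpower x nu) by apply exp_pos.
      assert (c <= Rpower x nu).
      { apply Rle_trans with (1 := Hcg), Rle_Rpower_l; lra. }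
      apply Rmult_le_reg_r with (1 := Hpx).
      replace ((1 - c / Rpower x nu) * Rpower x nu) with (Rpower x nu - c)
        by (field; lra).
      lra. }
    pose proof (barrier_step nu q c d M x Hx Hq HM (Hbar x Hgx)) as Hb.
    (* One factor of the telescoping product: 1 - c/x^ν <= 1 - (h(x+1) - h(x)) <= exp (h(x) -
       h(x+1)). *)
    assert (He : (1 - c / Rpower x nu) * exp (- h x) <= exp (- h (x + 1))).
    { replace (- h (x + 1)) with (- (h (x + 1) - h x) + - h x) by ring.
      rewrite exp_plus.
      apply Rmult_le_compat_r; [left; apply exp_pos |].
      pose proof (exp_ineq1_le (- (h (x + 1) - h x))).
      specialize (Hh x Hgx). lra. }
    assert (HPe : 0 <= P * exp (h gamma))
      by (apply Rmult_le_pos; [exact HP | left; apply exp_pos]).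
    apply (Rmult_le_compat_l _ _ _ HPe) in He.
    apply (Rmult_le_compat_l _ _ _ Hr) in IH.
    lra.
Qed.

Theorem lemma2p4
  (K : nat) (a : nat -> R) (nu q c d gamma : R)
  (Ha : forall k : nat, (k <= K + 1)%nat -> 0 < a k)
  (Hrec : forall k : nat, (k <= K)%nat ->
     a (k + 1)%nat <= (1 - c / Rpower (INR k + gamma) nu) * a k
                      + d / Rpower (INR k + gamma) (nu + q))
  (Hnu : 0 < nu <= 1) (Hq : 0 < q) (Hc : 0 < c) (Hd : 0 < d)
  (Hgamma : gamma >= Rpower c (1 / nu)) :
  (0 < nu < 1 -> gamma >= Rpower c (1 / nu) ->
   gamma > Rpower (q / c) (1 / (1 - nu)) ->
   let lambda := c * Rpower gamma (1 - nu) / (c * Rpower gamma (1 - nu) - q) in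
   forall k : nat, (k <= K)%nat ->
     a (k + 1)%nat <=
       lambda * d / c * Rpower (INR k + 1 + gamma) (- q)
       + pos_part (a 0%nat - lambda * d / (c * Rpower gamma q))
         * exp (c * Rpower gamma (1 - nu) / (1 - nu))
         * exp (- (c * Rpower (INR k + 1 + gamma) (1 - nu) / (1 - nu))))
  /\
  (nu = 1 -> c > q -> gamma >= c ->
   forall k : nat, (k <= K)%nat ->
     a (k + 1)%nat <=
       d / (c - q) * Rpower (INR k + 1 + gamma) (- q)
       + Rpower gamma c
         * pos_part (a 0%nat - d / ((c - q) * Rpower gamma q))
         * Rpower (INR k + 1 + gamma) (- c)).
Proof.
  (* [Rpower] is an exponential, so the lower bound on γ forces γ > 0. *)
  assert (Hg : 0 < gamma) by (pose proof (exp_pos (1 / nu * ln c)); unfold Rpower in Hgamma; lra).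
  assert (Hcg : c <= Rpower gamma nu) by (apply Rpower_inv_le; lra).
  split.
  - intros Hnu1 _ Hgq lambda k Hk.
    (* The strict condition on γ amounts to c γ^(1-ν) > q, so the denominator of [lambda] is
       positive. *)
    assert (HG : q / c < Rpower gamma (1 - nu)).
    { apply Rpower_inv_lt; [apply Rdiv_lt_0_compat; assumption | lra | lra]. }
    assert (HcG : 0 < c * Rpower gamma (1 - nu) - q).
    { apply (Rmult_lt_compat_l c) in HG; [| exact Hc].
      replace (c * (q / c)) with q in HG by (field; lra). lra. }
    assert (Hgpos : 0 < Rpower gamma (1 - nu)) by apply exp_pos.
    set (G := Rpower gamma (1 - nu)) in *.
    assert (HM : lambda * d / c = G * d / (c * G - q)) by (unfold lambda; field; lra).
    assert (HM0 : 0 <= lambda * d / c).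
    { rewrite HM. left; apply Rdiv_lt_0_compat; [apply Rmult_lt_0_compat |]; lra. }
    (* M = λd/c turns the barrier condition into an equality at x = γ; for x >= γ it then holds
       because x^(ν-1) decreases. *)
    assert (HMd : d + q * (lambda * d / c) * / G = c * (lambda * d / c))
      by (rewrite HM; field; lra).
    pose proof (recursion_bound K a (fun x => c * Rpower x (1 - nu) / (1 - nu))
      nu q c d gamma (lambda * d / c) Hrec Hg ltac:(lra) ltac:(lra) HM0 Hcg) as B.
    cbv beta in B. fold G in B.
    replace (lambda * d / (c * Rpower gamma q))
      with (lambda * d / c * Rpower gamma (- q)).
    2:{ rewrite Rpower_Ropp. pose proof (exp_pos (q * ln gamma)).
        unfold Rpower; field; lra. }
    replace (INR k + 1 + gamma) with (INR (k + 1) + gamma)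
      by (rewrite plus_INR; simpl; ring).
    apply B; [ | | lia].
    + intros x Hx. rewrite <- HMd.
      apply Rplus_le_compat_l, Rmult_le_compat_l; [apply Rmult_le_pos; lra |].
      replace (nu - 1) with (- (1 - nu)) by ring.
      rewrite Rpower_Ropp. apply Rinv_le_contravar; [exact Hgpos |].
      apply Rle_Rpower_l; lra.
    + intros x Hx.
      pose proof (Rpower_succ_diff x (1 - nu) ltac:(lra) ltac:(lra)) as H.
      replace (1 - nu - 1) with (- nu) in H by ring.
      rewrite Rpower_Ropp in H.
      apply (Rmult_le_compat_l (c / (1 - nu))) in H;
        [| left; apply Rdiv_lt_0_compat; lra].
      replace (c / Rpower x nu) with (c / (1 - nu) * ((1 - nu) * / Rpower x nu))
        by (pose proof (exp_pos (nu * ln x)); unfold Rpower; field; lra).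
      unfold Rdiv in *; lra.
  - intros Hnu1 Hcq _ k Hk. subst nu.
    assert (HM0 : 0 <= d / (c - q)) by (left; apply Rdiv_lt_0_compat; lra).
    pose proof (recursion_bound K a (fun x => c * ln x)
      1 q c d gamma (d / (c - q)) Hrec Hg ltac:(lra) ltac:(lra) HM0 Hcg) as B.
    cbv beta in B.
    replace (d / ((c - q) * Rpower gamma q))
      with (d / (c - q) * Rpower gamma (- q)).
    2:{ rewrite Rpower_Ropp. pose proof (exp_pos (q * ln gamma)).
        unfold Rpower; field; lra. }
    replace (INR k + 1 + gamma) with (INR (k + 1) + gamma)
      by (rewrite plus_INR; simpl; ring).
    (* With h = c ln, exp (h γ) is γ^c by unfolding [Rpower]; only the factor order and the form of
       the last exponent need adjusting. *)
    rewrite (Rmult_comm (Rpower gamma c)).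
    replace (Rpower (INR (k + 1) + gamma) (- c))
      with (exp (- (c * ln (INR (k + 1) + gamma))))
      by (unfold Rpower; f_equal; ring).
    apply B; [ | | lia].
    (* For ν = 1 the barrier condition is free of x and reads d + q M <= c M, an equality for M =
       d/(c-q). *)
    + intros x Hx. replace (1 - 1) with 0 by ring.
      rewrite Rpower_O by lra. right; field; lra.
    + intros x Hx. rewrite Rpower_1 by lra.
      pose proof (Rmult_le_compat_l c _ _ ltac:(lra) (ln_succ_diff x ltac:(lra))).
      unfold Rdiv; lra.
Qed.
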